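(* Let $X_1,X_2,\dots$ be i.i.d. from $F_\theta$, $\theta\in\Theta$, with natural filtration $(\mathcal F_n)_{n\ge1}$, and consider testing $H_0:\theta=\theta_0$ against $H_1:\theta\ne\theta_0$. (1) Let $(T(\alpha),\delta(\alpha))_{\alpha\in(0,1)}$ be a sequential test. Then $$p_n=\inf\{\alpha\in(0,1): T(\alpha)\le n,\ \delta(\alpha)=1\},\qquad n\ge 1,$$ defines an always valid p-value process. (2) For any always valid p-value process $(p_n)_{n\ge1}$, the family $$\tilde T(\alpha)=\inf\{n: p_n\le\alpha\},\qquad \tilde\delta(\alpha)=\mathbf 1\{\tilde T(\alpha)<\infty\},\qquad \alpha\in(0,1),$$ is a sequential test. If moreover $(p_n)_{n\ge1}$ was derived from a sequential test $(T(\alpha),\delta(\alpha))$ as in part (1), and $T(\alpha)=\infty$ whenever $\delta(\alpha)=0$, then $(\tilde T(\alpha),\tilde\delta(\alpha))=(T(\alpha),\delta(\alpha))$.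
   Context: $F_\theta$ is an exponential family with parameter $\theta\in\Theta\subset\mathbb R^p$; $\mathbb P_\theta$ is the law under $\theta$. A decision rule is a pair $(T,\delta)$ where $T$ is a (possibly infinite) stopping time for $(\mathcal F_n)$ and $\delta\in\{0,1\}$ is $\mathcal F_T$-measurable ($\delta=1$ means $H_0$ is rejected), with $\delta=0$ a.s. on $\{T=\infty\}$. A sequential test is a family of decision rules $(T(\alpha),\delta(\alpha))$, $\alpha\in(0,1)$, such that (i) (nested) $T(\alpha)$ is a.s. nonincreasing in $\alpha$ and $\delta(\alpha)$ is a.s. nondecreasing in $\alpha$; (ii) $\mathbb P_{\theta_0}(\delta(\alpha)=1)\le\alpha$ for each $\alpha$. A fixed horizon p-value at $n$ is a $[0,1]$-valued $\mathcal F_n$-measurable random variable $p_n$ with $\mathbb P_{\theta_0}(p_n\le s)\le s$ for all $s\in[0,1]$. An always valid p-value process is a sequence $(p_n)$ of fixed horizon p-values such that for every (possibly infinite) stopping time $T$ with respect to $(\mathcal F_n)$ and all $s\in[0,1]$, $\mathbb P_{\theta_0}(p_T\le s)\le s$. The event $\{p_T\le s\}$ is understood as $\{T<\infty,\ p_T\le s\}$. The infimum of the empty set is $1$ in the definition of $p_n$ and $\infty$ in the definition of $\tilde T(\alpha)$.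
   Formalization: The filtration is augmented by null sets and the model complete; nestedness holds a.s. for all levels at once; the final equality, false in general, is asserted a.s. for all but countably many α, and at each α exactly when T is a.s. right-continuous there. *)

(* Defs.v *)
(* MathComp-Analysis world. *)
From HB Require Import structures.
From mathcomp Require Import all_boot all_order all_algebra.
From mathcomp Require Import all_classical all_reals all_analysis.
Set Implicit Arguments.
Unset Strict Implicit.
Unset Printing Implicit Defensive.
Import Order.TTheory GRing.Theory Num.Theory.
Import numFieldNormedType.Exports.
Local Open Scope classical_set_scope.
Local Open Scope ring_scope.

(* Indexing convention: the observations X_1, X_2, ... are X 0, X 1, ..., and
   the index n stands for time n + 1 everywhere (filtration, p-values, values
   of stopping times).  Only comparisons between times occur, so nothing but
   the labels is affected. *)

(* Times in {1, 2, ...} together with infinity, which is None. *)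
Definition le_time (s t : option nat) : bool :=
  match s, t with
  | _, None => true
  | Some m, Some n => (m <= n)%N
  | None, Some _ => false
  end.

(* The least index satisfying A, and infinity if there is none. *)
Definition first_time (A : pred nat) : option nat :=
  match pselect (exists n, A n) with
  | left e => Some (ex_minn e)
  | right _ => None
  end.

Section Model.
Context {d d' : measure_display} {Omega : measurableType d}
  {E : measurableType d'} {R : realType} {p : nat}.

(* Densities h(x) exp(<eta(theta), S(x)> - A(theta)) with respect to one
   sigma-finite measure; eta = id gives the canonical parametrization. *)
Definition exponential_family (Theta : set 'rV[R]_p)
    (F : 'rV[R]_p -> probability E R) : Prop :=
  exists (k : nat) (mu : {sigma_finite_measure set E -> \bar R}) (h : E -> R)
    (S : 'I_k -> E -> R) (eta : 'rV[R]_p -> 'I_k -> R) (A : 'rV[R]_p -> R),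
    [/\ measurable_fun setT h, forall x, 0 <= h x,
        forall i, measurable_fun setT (S i) &
        forall theta, Theta theta -> forall B, measurable B ->
          F theta B = (\int[mu]_(x in B)
            (h x * expR (\sum_(i < k) eta theta i * S i x - A theta))%:E)%E].

Variables (Theta : set 'rV[R]_p) (P : 'rV[R]_p -> probability Omega R).

(* The null sets of the model: negligible under every theta in Theta. *)
Definition null_sets : set (set Omega) :=
  [set N | forall theta, Theta theta -> (P theta).-negligible N].

Definition complete_model : Prop := null_sets `<=` measurable.

Definition almost_surely (Q : Omega -> Prop) : Prop :=
  forall theta, Theta theta -> {ae P theta, forall w, Q w}.

Definition mutually_independent (mu : probability Omega R)
    (X : nat -> Omega -> E) : Prop :=
  forall (J : seq nat) (B : nat -> set E), uniq J ->
    (forall i, measurable (B i)) ->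
    mu (\bigcap_(i in [set` J]) X i @^-1` B i)
    = \big[mule/1%E]_(i <- J) mu (X i @^-1` B i).

Definition iid_sample (F : 'rV[R]_p -> probability E R)
    (X : nat -> Omega -> E) : Prop :=
  (forall n, measurable_fun setT (X n)) /\
  forall theta, Theta theta ->
    mutually_independent (P theta) X /\
    forall n B, measurable B -> P theta (X n @^-1` B) = F theta B.

Variable X : nat -> Omega -> E.

(* The natural filtration, augmented by the null sets of the model.  Since
   sequential tests are nested only almost surely, the infimum over the
   uncountably many levels in pvalue_of_test need not be measurable for the
   filtration without null sets. *)
Definition natural_filtration (n : nat) : set (set Omega) :=
  <<s null_sets `|`
      \bigcup_(i in [set i | (i <= n)%N])
        preimage_set_system setT (X i) measurable >>.

Definition filtration_infty : set (set Omega) :=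
  <<s null_sets `|` \bigcup_i preimage_set_system setT (X i) measurable >>.

Definition stopping_time (T : Omega -> option nat) : Prop :=
  forall n, natural_filtration n [set w | le_time (T w) (Some n)].

Definition stopped_sigma_algebra (T : Omega -> option nat)
  : set (set Omega) :=
  [set A | filtration_infty A /\
    forall n, natural_filtration n (A `&` [set w | le_time (T w) (Some n)])].

(* The value true of the decision means that H_0 is rejected. *)
Definition decision_rule (T : Omega -> option nat) (delta : Omega -> bool)
  : Prop :=
  [/\ stopping_time T,
      stopped_sigma_algebra T [set w | delta w] &
      almost_surely (fun w => T w = None -> delta w = false)].

Variable theta0 : 'rV[R]_p.

(* Nestedness holds almost surely for all pairs of levels simultaneously. *)
Definition sequential_test (T : R -> Omega -> option nat)
    (delta : R -> Omega -> bool) : Prop :=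
  [/\ forall a, 0 < a < 1 -> decision_rule (T a) (delta a),
      almost_surely (fun w => forall a b, 0 < a -> a <= b -> b < 1 ->
        le_time (T b w) (T a w) /\ (delta a w -> delta b w)) &
      forall a, 0 < a < 1 -> (P theta0 [set w | delta a w] <= a%:E)%E].

Definition fixed_horizon_pvalue (n : nat) (q : Omega -> R) : Prop :=
  [/\ forall w, 0 <= q w <= 1,
      forall B : set R, measurable B -> natural_filtration n (q @^-1` B) &
      forall s, 0 <= s <= 1 -> (P theta0 [set w | (q w <= s)%R] <= s%:E)%E].

Definition always_valid (q : nat -> Omega -> R) : Prop :=
  (forall n, fixed_horizon_pvalue n (q n)) /\
  forall T, stopping_time T -> forall s, 0 <= s <= 1 ->
    (P theta0 [set w | exists2 n, T w = Some n & (q n w <= s)%R] <= s%:E)%E.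

End Model.

Section Transforms.
Context {Omega : Type} {R : realType}.

(* MathComp's inf of the empty set is 0, hence the case distinction. *)
Definition pvalue_of_test (T : R -> Omega -> option nat)
    (delta : R -> Omega -> bool) (n : nat) (w : Omega) : R :=
  let S := [set a : R |
             [/\ 0 < a < 1, le_time (T a w) (Some n) & delta a w]] in
  if `[< S = set0 >] then 1 else inf S.

Definition time_of_pvalue (q : nat -> Omega -> R) (a : R) (w : Omega)
  : option nat :=
  first_time (fun n => q n w <= a).

Definition decision_of_pvalue (q : nat -> Omega -> R) (a : R) (w : Omega)
  : bool :=
  isSome (time_of_pvalue q a w).

(* Convergence of T b w to T a w as b decreases to a, in the one-point
   compactification of the discrete set of times (T b w may tend to infinity
   through finite values).  The p-value is an infimum over levels, so the test
   recovered from it at level a is the right limit at a of the original one: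
   the event T a = infinity, T b = 0 for all b > a, is compatible with the
   definition of a sequential test and gives recovered time 0 at level a. *)
Definition right_continuous_at (T : R -> Omega -> option nat) (a : R)
    (w : Omega) : Prop :=
  forall n, \forall b \near a^'+,
    le_time (T b w) (Some n) = le_time (T a w) (Some n).

End Transforms.

(* Main.v *)
(** On a path where the test is nested, [p_n < r] holds iff some level [a < r]
    has rejected by time [n], and such levels may be taken rational: hence
    [p_n] is adapted.  Moreover [p_tau <= s] forces rejection at every level
    [b > s], so it has probability at most [b], and then at most [s].

    The test recovered from the p-values at level [a] stops at the limit of
    [T b] as [b] decreases to [a], computed along rational [b].  It is [T a]
    iff this path has no jump at [a], and jumps have positive probability for
    countably many [a] only, because each [P (T a <= n)] is nondecreasing in
    [a]. *)
Require Import Defs.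
From HB Require Import structures.
From mathcomp Require Import all_boot all_order all_algebra.
From mathcomp Require Import all_classical all_reals all_analysis.
Import Order.TTheory GRing.Theory Num.Theory.
Import numFieldNormedType.Exports.
Local Open Scope classical_set_scope.
Local Open Scope ring_scope.

Set Implicit Arguments.
Unset Strict Implicit.
Unset Printing Implicit Defensive.

(** * Times with infinity and first passage times *)

Lemma le_time_trans t s u : le_time s t -> le_time t u -> le_time s u.
Proof. by case: s t u => [s|] [t|] [u|] //=; exact: leq_trans. Qed.

(** Reduces equality of times to the events [T <= n], the only ones that stopping times and p-values
    involve. *)
Lemma eq_time s t :
  (forall n, le_time s (Some n) <-> le_time t (Some n)) -> s = t.
Proof.
case: s t => [s|] [t|] h //=.
- congr Some; apply/eqP; rewrite eqn_leq; apply/andP; split.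
    exact: (h t).2 (leqnn t).
  exact: (h s).1 (leqnn s).
- by have := (h s).1 (leqnn s).
- by have := (h t).2 (leqnn t).
Qed.

Lemma le_first_time (A : pred nat) n :
  le_time (first_time A) (Some n) <-> exists2 m, (m <= n)%N & A m.
Proof.
rewrite /first_time; case: pselect => [e|ne] /=; last first.
  by split=> // -[m _ Am]; case: ne; exists m.
case: ex_minnP => k Ak kmin; split=> [kn|[m mn Am]]; first by exists k.
exact: leq_trans (kmin _ Am) mn.
Qed.

Lemma first_time_Some (A : pred nat) n : first_time A = Some n -> A n.
Proof.
by rewrite /first_time; case: pselect => // e; case: ex_minnP => m Am _ [<-].
Qed.

(** * The p-value and the recovered test on one fixed path *)

Section Paths.
Context {Omega : Type} {R : realType}.
Variables (T : R -> Omega -> option nat) (delta : R -> Omega -> bool).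
Implicit Types (a b : R) (n : nat) (w : Omega).

Definition nested w := forall a b, 0 < a -> a <= b -> b < 1 ->
  le_time (T b w) (T a w) /\ (delta a w -> delta b w).

(** Joins the two implications available almost surely: no rejection at time infinity, and
    [T = infinity] whenever the test does not reject. *)
Definition decided a w := delta a w = isSome (T a w).

Lemma pvalue_of_test01 n w : 0 <= pvalue_of_test T delta n w <= 1.
Proof.
rewrite /pvalue_of_test; case: asboolP => [_|/eqP/set0P S0].
  by rewrite ler01 lexx.
apply/andP; split.
  by apply: lb_le_inf => // a [/andP[/ltW]].
case: (S0) => a Sa; have [/andP[a0 a1] _ _] := Sa.
apply: le_trans (ltW a1); apply: ge_inf => //.
by exists 0 => b [/andP[/ltW]].
Qed.

Lemma pvalue_of_test_le n w a :
  0 < a < 1 -> le_time (T a w) (Some n) -> delta a w ->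
  pvalue_of_test T delta n w <= a.
Proof.
move=> a01 Ta da; rewrite /pvalue_of_test; case: asboolP => [S0|_].
  suff: (set0 : set R) a by [].
  by rewrite -S0.
apply: ge_inf => //.
by exists 0 => b [/andP[/ltW]].
Qed.

(** The bound [r <= 1] excludes the default value 1 of the empty infimum, so the set of rejecting
    levels is nonempty. *)
Lemma pvalue_of_test_lt n w r : r <= 1 -> pvalue_of_test T delta n w < r ->
  exists2 a, a < r & [/\ 0 < a < 1, le_time (T a w) (Some n) & delta a w].
Proof.
rewrite /pvalue_of_test; case: asboolP => [_ r1 /(le_lt_trans r1)|].
  by rewrite ltxx.
by move=> /eqP/set0P S0 _ /(inf_lt S0)[a Sa ar]; exists a.
Qed.

(** Nestedness moves a rejecting level up to a rational one still below [r]; this turns an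
    uncountable union of events into a countable one. *)
Lemma pvalue_of_test_lt_rat n w r : nested w -> r <= 1 ->
  pvalue_of_test T delta n w < r ->
  exists q : rat, [/\ 0 < (ratr q : R) < 1, ratr q < r,
    le_time (T (ratr q) w) (Some n) & delta (ratr q) w].
Proof.
move=> nest r1 /(pvalue_of_test_lt r1)[a ar [/andP[a0 a1] Ta da]].
have [q /[!in_itv]/= /andP[aq qr]] := rat_in_itvoo ar.
have q1 : ratr q < 1 :> R by exact: lt_le_trans qr r1.
have [Tq dq] := nest _ _ a0 (ltW aq) q1.
exists q; split; rewrite ?q1 ?(lt_trans a0) //; last exact: dq.
exact: le_time_trans Tq Ta.
Qed.

(** The infimum need not be attained, so rejection is obtained only strictly above [a]. *)
Lemma pvalue_of_test_lt_level n w a b : nested w -> a < b < 1 ->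
  pvalue_of_test T delta n w <= a ->
  le_time (T b w) (Some n) /\ delta b w.
Proof.
move=> nest /andP[ab b1] pa.
have [c cb [/andP[c0 c1] Tc dc]] :=
  pvalue_of_test_lt (ltW b1) (le_lt_trans pa ab).
have [Tb db] := nest _ _ c0 (ltW cb) b1.
by split; [exact: le_time_trans Tb Tc|exact: db].
Qed.

Definition rat_above a : set rat := [set r | a < (ratr r : R) < 1].

(** For the converse, a rational level strictly between [a] and the p-value would have stopped by
    [n], hence rejected, and would bound the p-value from above. *)
Lemma pvalue_of_test_leP n w a : nested w ->
  (forall r, rat_above 0 r -> decided (ratr r) w) -> 0 < a < 1 ->
  pvalue_of_test T delta n w <= a <->
  forall r, rat_above a r -> le_time (T (ratr r) w) (Some n).
Proof.
move=> nest dec /andP[a0 a1]; split=> [pa r ar|Tn].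
  by have [] := pvalue_of_test_lt_level nest ar pa.
rewrite leNgt; apply/negP => ap.
have [r /[!in_itv]/= /andP[ar rp]] := rat_in_itvoo ap.
have /andP[_ p1] := pvalue_of_test01 n w.
have r1 : ratr r < 1 :> R := lt_le_trans rp p1.
have Tr : le_time (T (ratr r) w) (Some n) by apply: Tn; apply/andP.
have r0 : 0 < (ratr r : R) by exact: lt_trans ar.
have dr : delta (ratr r) w.
  by rewrite dec /rat_above/= ?r0//; case: (T _ w) Tr.
move: rp; rewrite ltNge => /negP; apply.
by apply: pvalue_of_test_le; rewrite ?r0.
Qed.

(* By nestedness the converse implication always holds, so this says that
   [T b w] tends to [T a w] as the rational [b] decreases to [a]. *)
Definition no_jump a w := forall n,
  (forall r, rat_above a r -> le_time (T (ratr r) w) (Some n)) ->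
  le_time (T a w) (Some n).

(** By [pvalue_of_test_leP] the recovered time is the limit of [T] along rational levels decreasing
    to [a]; nestedness bounds it by [T a w]. Decisions follow, both being finiteness of the time. *)
Lemma recovered_iff_no_jump w a : nested w ->
  (forall r, rat_above 0 r -> decided (ratr r) w) -> decided a w ->
  0 < a < 1 ->
  (time_of_pvalue (pvalue_of_test T delta) a w,
   decision_of_pvalue (pvalue_of_test T delta) a w) = (T a w, delta a w)
  <-> no_jump a w.
Proof.
move=> nest dec deca a01; have /andP[a0 a1] := a01.
set q := pvalue_of_test T delta.
have timeP n : le_time (time_of_pvalue q a w) (Some n) <->
    forall r, rat_above a r -> le_time (T (ratr r) w) (Some n).
  rewrite le_first_time; split=> [[m mn /(pvalue_of_test_leP _ nest dec a01)]|].
    by move=> h r /h /le_time_trans; exact.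
  by move=> h; exists n => //; apply/pvalue_of_test_leP.
split=> [[Tq _] n /timeP|nj]; first by rewrite Tq.
have Tq : time_of_pvalue q a w = T a w.
  apply: eq_time => n; split=> [/timeP/nj//|Tan].
  apply/timeP => r /andP[ar r1].
  exact: le_time_trans (nest _ _ a0 (ltW ar) r1).1 Tan.
by rewrite /decision_of_pvalue Tq deca.
Qed.

Lemma right_continuous_iff_no_jump w a : nested w -> 0 < a < 1 ->
  right_continuous_at T a w <-> no_jump a w.
Proof.
move=> nest /andP[a0 a1]; split=> [rc n Tn|nj n].
  have {}rc : \forall b \near a^'+, a < b < 1 /\
      le_time (T b w) (Some n) = le_time (T a w) (Some n).
    near=> b; split; last by near: b; exact: rc.
    apply/andP; split; near: b; [exact: nbhs_right_gt|exact: nbhs_right_lt].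
  (* A level [b] near [a] has the same status at [n] as [a]; a rational level between them has
     stopped by [n], hence so has [b]. *)
  have [b [/andP[ab b1] <-]] := filter_ex rc.
  have [r /[!in_itv]/= /andP[ar rb]] := rat_in_itvoo ab.
  have r0 : 0 < (ratr r : R) := lt_trans a0 ar.
  apply: le_time_trans (nest _ _ r0 (ltW rb) b1).1 _.
  by apply: Tn; rewrite /rat_above/= ar (lt_trans rb).
have [Tan|Tan] := boolP (le_time (T a w) (Some n)).
  near=> b; apply/idP.
  apply: le_time_trans (nest a b a0 _ _).1 Tan.
    by apply: ltW; near: b; exact: nbhs_right_gt.
  by near: b; exact: nbhs_right_lt.
(* Some rational level [r] above [a] is still running at [n]; by nestedness so is every [b] in
   [(a, r]]. *)
have : ~ forall r, rat_above a r -> le_time (T (ratr r) w) (Some n).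
  by move=> /nj; exact/negP.
move=> /existsNP[r /not_implyP[/andP[ar r1] Trn]].
near=> b; apply/negP => Tbn; apply: Trn.
have ab : a < b by near: b; exact: nbhs_right_gt.
have br : b <= ratr r by apply: ltW; near: b; exact: nbhs_right_lt.
exact: le_time_trans (nest _ _ (lt_trans a0 ab) br r1).1 Tbn.
Unshelve. all: by end_near. Qed.

End Paths.

(** * Closure properties of generated sigma-algebras *)

Section GeneratedSigmaAlgebra.
Context {T : pointedType} (G : set (set T)).

Lemma sigma_algebraI A B : <<s G >> A -> <<s G >> B -> <<s G >> (A `&` B).
Proof. exact: (@measurableI _ (g_sigma_algebraType G)). Qed.

Lemma sigma_algebraU A B : <<s G >> A -> <<s G >> B -> <<s G >> (A `|` B).
Proof. exact: (@measurableU _ (g_sigma_algebraType G)). Qed.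

Lemma sigma_algebra_bigcup_count (I : countType) (D : set I)
    (A : I -> set T) : (forall i, D i -> <<s G >> (A i)) ->
  <<s G >> (\bigcup_(i in D) A i).
Proof.
move=> GA; rewrite bigcup_mkcond.
apply: (@countable_bigcupT_measurable _ (g_sigma_algebraType G)) => [//|i].
case: ifPn => [/set_mem/GA//|_]; exact: sigma_algebra0.
Qed.

Lemma sigma_algebra_preimage_real (R : realType) (q : T -> R) :
  (forall s, <<s G >> (q @^-1` `]-oo, s[)) ->
  forall B : set R, measurable B -> <<s G >> (q @^-1` B).
Proof.
move=> Gq B mB.
have mq : measurable_fun (setT : set (g_sigma_algebraType G)) q.
  apply: (measurability _ (measurable_realfun.RGenInftyO.measurableE R)).
  by move=> _ [_ [s ->] <-]; rewrite setTI; exact: Gq.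
by have := mq measurableT _ mB; rewrite setTI.
Qed.

End GeneratedSigmaAlgebra.

(** * Comparison up to null sets, and countability of jumps *)

Section AlmostEverywhere.
Context d (Omega : measurableType d) (R : realType).

Lemma ae_le_measure (mu : {measure set Omega -> \bar R}) (A B : set Omega) :
  measurable A -> measurable B -> mu.-negligible (A `\` B) ->
  (mu A <= mu B)%E.
Proof.
move=> mA mB AB; rewrite (measureDI mu mA mB) measure_negligible// ?add0e.
  by apply: le_measure; rewrite ?inE//; exact: measurableI.
exact: measurableD.
Qed.

Lemma ae_all_count (mu : {measure set Omega -> \bar R}) (I : countType)
    (Q : I -> Omega -> Prop) :
  (forall i, {ae mu, forall w, Q i w}) -> {ae mu, forall w i, Q i w}.
Proof.
move=> Qi; have : {ae mu, forall w n i, unpickle n = Some i -> Q i w}.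
  apply/ae_foralln => n; case: (unpickle n) => [i|]; last by apply: nearW.
  by apply: filterS (Qi i) => w Qw j [<-].
by apply: filterS => w Qw i; apply: (Qw (pickle i)); rewrite pickleK.
Qed.

(* Each rational lies in the jump of [f] at at most one point, since the jump
   intervals of a nondecreasing function are disjoint. *)
Lemma countable_right_jumps (f : R -> \bar R) (J : set R) :
  countable [set a | exists q : rat,
    [/\ J a, (f a < (ratr q)%:E)%E &
        forall b, J b -> a < b -> ((ratr q)%:E <= f b)%E]].
Proof.
pose D (q : rat) := [set a | [/\ J a, (f a < (ratr q)%:E)%E &
        forall b, J b -> a < b -> ((ratr q)%:E <= f b)%E]].
suff : countable (\bigcup_(q in [set: rat]) D q).
  by apply: sub_countable; apply: subset_card_le => a [q Dq]; exists q.
apply: bigcup_countable => // q _.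
have [->|/set0P[a Da]] := eqVneq (D q) set0; first exact: countable0.
suff -> : D q = [set a] by exact: countable1.
apply/seteqP; split=> [b Db /=|_ -> //].
case: Da Db => [Ja fa ja] [Jb fb jb].
have [ab|ba|//] := ltgtP a b.
- by have := lt_le_trans fb (ja _ Jb ab); rewrite ltxx.
- by have := lt_le_trans fa (jb _ Ja ba); rewrite ltxx.
Qed.

End AlmostEverywhere.

(** * The augmented natural filtration *)

Section Model.
Context {d d' : measure_display} {Omega : measurableType d}
  {E : measurableType d'} {R : realType} {p : nat}.
Variables (Theta : set 'rV[R]_p) (P : 'rV[R]_p -> probability Omega R)
  (X : nat -> Omega -> E).

Lemma natural_filtration_null n N :
  null_sets Theta P N -> natural_filtration Theta P X n N.
Proof. by move=> nN; apply: sub_sigma_algebra; left. Qed.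

Lemma natural_filtration_mono m n : (m <= n)%N ->
  natural_filtration Theta P X m `<=` natural_filtration Theta P X n.
Proof.
move=> mn; apply: sub_sigma_algebra2; apply: setUS.
by apply: bigcup_subset => i /= /leq_trans; exact.
Qed.

Lemma natural_filtration_infty n :
  natural_filtration Theta P X n `<=` filtration_infty Theta P X.
Proof. by apply: sub_sigma_algebra2; apply: setUS; exact: bigcup_subset. Qed.

Lemma natural_filtration_measurable n :
  complete_model Theta P -> (forall i, measurable_fun setT (X i)) ->
  natural_filtration Theta P X n `<=` measurable.
Proof.
move=> nullm mX; apply: smallest_sub; first exact: sigma_algebra_measurable.
move=> A [/nullm//|[i _ [B mB <-]]]; exact: mX.
Qed.

Lemma almost_surely_null_sets Q :
  almost_surely Theta P Q -> null_sets Theta P [set w | ~ Q w].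
Proof. by move=> asQ theta /asQ. Qed.

Lemma null_setsS A B :
  A `<=` B -> null_sets Theta P B -> null_sets Theta P A.
Proof. by move=> AB nB theta /nB; exact: negligibleS. Qed.

(** Augmentation at work: [A] is [B] off the null set where [Q] fails, plus a subset of that null
    set, which is itself null. *)
Lemma natural_filtration_ae n Q A B : almost_surely Theta P Q ->
  (forall w, Q w -> A w <-> B w) ->
  natural_filtration Theta P X n B -> natural_filtration Theta P X n A.
Proof.
move=> asQ AB FB; have nQ := almost_surely_null_sets asQ.
have -> : A = (B `&` ~` [set w | ~ Q w]) `|` (A `&` [set w | ~ Q w]).
  apply/seteqP; split=> w.
    have [Qw Aw|nQw Aw] := pselect (Q w); last by right.
    by left; split=> [|/(_ Qw)//]; exact/AB.
  by move=> [[Bw /contrapT Qw]|[]//]; exact/(AB _ Qw).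
apply: sigma_algebraU; last first.
  apply: natural_filtration_null; exact: null_setsS (@subIsetr _ _ _) nQ.
apply: sigma_algebraI => //; apply: sigma_algebraC.
exact: natural_filtration_null.
Qed.

Lemma stopping_time_eq T n : stopping_time Theta P X T ->
  natural_filtration Theta P X n [set w | T w = Some n].
Proof.
move=> sT; case: n => [|n].
  suff -> : [set w | T w = Some 0%N] = [set w | le_time (T w) (Some 0%N)].
    exact: sT.
  apply/seteqP; split=> w /= => [->//|].
  by case: (T w) => [m|]//=; rewrite leqn0 => /eqP ->.
suff -> : [set w | T w = Some n.+1] =
    [set w | le_time (T w) (Some n.+1)] `&` ~` [set w | le_time (T w) (Some n)].
  apply: sigma_algebraI; first exact: sT.
  apply: sigma_algebraC; apply: natural_filtration_mono (sT n); exact: leqnSn.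
apply/seteqP; split=> w /=.
  by move=> -> /=; rewrite ltnn.
case: (T w) => [m|] /= [mn nmn] //; congr Some; apply/eqP.
by rewrite eqn_leq mn ltnNge; exact/negP.
Qed.

(** * From tests to p-values and back *)

Variable theta0 : 'rV[R]_p.

Lemma sequential_test_level T delta a n :
  sequential_test Theta P X theta0 T delta -> 0 < a < 1 ->
  natural_filtration Theta P X n
    [set w | delta a w /\ le_time (T a w) (Some n)].
Proof. by move=> [rule _ _] /rule[_ [_ /(_ n)]]. Qed.

Lemma sequential_test_nested T delta :
  sequential_test Theta P X theta0 T delta ->
  almost_surely Theta P (nested T delta).
Proof. by case. Qed.

Lemma pvalue_of_test_adapted T delta n :
  sequential_test Theta P X theta0 T delta -> forall B : set R, measurable B ->
  natural_filtration Theta P X n (pvalue_of_test T delta n @^-1` B).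
Proof.
move=> test; apply: sigma_algebra_preimage_real => s.
(* Above 1 the ray contains every value of the p-value, the default included; below, rational levels
   suffice. *)
have [s1|s1] := leP s 1; last first.
  suff -> : pvalue_of_test T delta n @^-1` `]-oo, s[ = setT.
    exact: (@measurableT _ (g_sigma_algebraType _)).
  apply/seteqP; split=> // w _ /=; rewrite in_itv/=.
  by have /andP[_ /le_lt_trans] := pvalue_of_test01 T delta n w; exact.
apply: (natural_filtration_ae
  (B := \bigcup_(q in [set q : rat | 0 < (ratr q : R) < 1 /\ ratr q < s])
     [set w | delta (ratr q) w /\ le_time (T (ratr q) w) (Some n)])
  (sequential_test_nested test)); last first.
  apply: sigma_algebra_bigcup_count => q [q01 _].
  exact: sequential_test_level test q01.
move=> w nest /=; rewrite in_itv/=; split.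
  by move=> /(pvalue_of_test_lt_rat nest s1)[q [q01 qs Tq dq]]; exists q.
move=> [q [q01 qs] [dq Tq]].
exact: le_lt_trans (pvalue_of_test_le q01 Tq dq) qs.
Qed.

Hypotheses (hP : complete_model Theta P)
  (mX : forall i, measurable_fun setT (X i)) (h0 : Theta theta0).

(** Up to a null set [A] lies in the rejection event at each level [b > s], so its probability is at
    most [b]; let [b] decrease to [s]. The fixed horizon and the stopped bounds are both
    instances. *)
Lemma sequential_test_size T delta s (A : set Omega) :
  sequential_test Theta P X theta0 T delta -> 0 <= s <= 1 -> measurable A ->
  (forall w, nested T delta w -> A w -> forall b, s < b < 1 -> delta b w) ->
  (P theta0 A <= s%:E)%E.
Proof.
move=> test /andP[s0 s1] mA Adelta; apply/lee_addgt0Pr => e e0.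
(* When [s + e] is not a level, the bound is trivial as probabilities are at most 1. *)
have [b1|b1] := ltP (s + e) 1; last first.
  by rewrite -EFinD (le_trans (probability_le1 _ mA))// lee_fin.
have sb : s < s + e by rewrite ltrDl.
have b01 : 0 < s + e < 1 by rewrite (le_lt_trans s0 sb).
have [rule nest size] := test; apply: le_trans (size _ b01).
have mdelta : measurable [set w | delta (s + e) w].
  have [_ [+ _] _] := rule _ b01.
  apply: smallest_sub; first exact: sigma_algebra_measurable.
  by move=> B [/hP//|[i _ [C mC <-]]]; exact: mX.
apply: ae_le_measure => //; apply: negligibleS (nest _ h0) => w [Aw ndw] nestw.
by apply: ndw; apply: (Adelta w) => //; rewrite sb.
Qed.

Lemma pvalue_of_test_always_valid T delta :
  sequential_test Theta P X theta0 T delta ->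
  always_valid Theta P X theta0 (pvalue_of_test T delta).
Proof.
move=> test.
have adapted n s : natural_filtration Theta P X n
    [set w | pvalue_of_test T delta n w <= s].
  have := pvalue_of_test_adapted (n := n) test (measurable_itv `]-oo, s]).
  by congr natural_filtration; apply/seteqP; split=> w /=; rewrite in_itv.
have reject n s w : nested T delta w -> pvalue_of_test T delta n w <= s ->
    forall b, s < b < 1 -> delta b w.
  by move=> nest ps b sb; have [] := pvalue_of_test_lt_level nest sb ps.
split=> [n|tau stau s s01].
  split=> [w|B mB|s s01]; first exact: pvalue_of_test01.
    exact: pvalue_of_test_adapted.
  apply: sequential_test_size test s01 _ _ => [|w nest]; last exact: reject.
  exact: natural_filtration_measurable (adapted _ _).
apply: sequential_test_size test s01 _ _ => [|w nest [n _]]; last exact: reject.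
(* Splitting along the values of [tau] serves only to show measurability. *)
rewrite (_ : mkset _ = \bigcup_n ([set w | tau w = Some n] `&`
    [set w | pvalue_of_test T delta n w <= s])); last first.
  by apply/seteqP; split=> w [n]; [exists n|move=> _ []; exists n].
apply: bigcup_measurable => n _.
apply: (@natural_filtration_measurable n) => //; apply: sigma_algebraI.
  exact: stopping_time_eq.
exact: adapted.
Qed.

(** The size bound is the always valid bound applied to the recovered stopping time itself, with
    [s = a]: at a finite first passage the p-value is at most [a]. *)
Lemma time_of_pvalue_sequential_test q :
  always_valid Theta P X theta0 q ->
  sequential_test Theta P X theta0 (time_of_pvalue q) (decision_of_pvalue q).
Proof.
move=> [valid stopped].
have st a : stopping_time Theta P X (time_of_pvalue q a).
  move=> n; suff -> : [set w | le_time (time_of_pvalue q a w) (Some n)] =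
      \bigcup_(m in [set m | (m <= n)%N]) (q m @^-1` `]-oo, a]).
    apply: sigma_algebra_bigcup_count => m mn.
    apply: natural_filtration_mono mn _ _.
    by have [_ mq _] := valid m; apply: mq; exact: measurable_itv.
  apply/seteqP; split=> w /=.
    by move=> /le_first_time[m mn qm]; exists m; rewrite //= in_itv.
  by move=> [m mn]; rewrite /= in_itv/= => qm; apply/le_first_time; exists m.
have decE a : [set w | decision_of_pvalue q a w] =
    \bigcup_n [set w | le_time (time_of_pvalue q a w) (Some n)].
  apply/seteqP; split=> w; rewrite /= /decision_of_pvalue.
    case Tw: (time_of_pvalue q a w) => [n|]// _.
    by exists n; rewrite //= Tw /=.
  by move=> [n _ /=]; case: (time_of_pvalue q a w).
split=> [a a01||a /andP[a0 a1]].
- split=> //; last first.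
    by move=> theta _; apply: nearW => w; rewrite /decision_of_pvalue => ->.
  split=> [|n].
    rewrite decE; apply: sigma_algebra_bigcup_count => n _.
    exact: natural_filtration_infty (st a n).
  suff -> : [set w | decision_of_pvalue q a w] `&`
      [set w | le_time (time_of_pvalue q a w) (Some n)] =
      [set w | le_time (time_of_pvalue q a w) (Some n)] by exact: st.
  by apply/setIidr => w /= Tn; rewrite /decision_of_pvalue; case: (_ w) Tn.
- move=> theta _; apply: nearW => w a b _ ab _.
  have le_n n : le_time (time_of_pvalue q a w) (Some n) ->
      le_time (time_of_pvalue q b w) (Some n).
    move=> /le_first_time[m mn qa]; apply/le_first_time; exists m => //.
    exact: le_trans ab.
  move: le_n; rewrite /decision_of_pvalue.
  case: (time_of_pvalue q a w) => [n|] le_n; last first.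
    by case: (time_of_pvalue q b w).
  have Tb := le_n n (leqnn n); split=> // _.
  by case: (time_of_pvalue q b w) Tb.
- have := stopped _ (st a) a; rewrite (ltW a0) (ltW a1) => /(_ isT).
  congr (_ <= _)%E; congr (P theta0 _); apply/seteqP; split=> w /=.
    by move=> [n Tn _]; rewrite /decision_of_pvalue Tn.
  rewrite /decision_of_pvalue; case Tn : (time_of_pvalue q a w) => [n|]// _.
  by exists n => //; exact: first_time_Some Tn.
Qed.

(** * Recovering a test from its p-values *)

Section Recovery.
Variables (T : R -> Omega -> option nat) (delta : R -> Omega -> bool).
Hypotheses (test : sequential_test Theta P X theta0 T delta)
  (Tinf : forall a, 0 < a < 1 ->
     almost_surely Theta P (fun w => delta a w = false -> T a w = None)).
Variable theta : 'rV[R]_p.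
Hypothesis htheta : Theta theta.

Let agree a w := (time_of_pvalue (pvalue_of_test T delta) a w,
  decision_of_pvalue (pvalue_of_test T delta) a w) = (T a w, delta a w).

Lemma ae_decided a : 0 < a < 1 -> {ae P theta, forall w, decided T delta a w}.
Proof.
move=> a01; have [/(_ a a01)[_ _ /(_ _ htheta) dT] _ _] := test.
apply: filterS2 dT (Tinf a01 htheta) => w; rewrite /decided.
by case: (T a w) (delta a w) => [n|] [] //= => [_ /(_ erefl)|/(_ erefl)].
Qed.

(** The pathwise equivalences use nestedness and decidedness at [a] and at rational levels only:
    countably many almost sure events. *)
Lemma ae_regular a : 0 < a < 1 -> {ae P theta, forall w,
  (agree a w <-> no_jump T a w) /\
  (right_continuous_at T a w <-> no_jump T a w)}.
Proof.
move=> a01.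
have decr : {ae P theta, forall w (r : rat), rat_above (0 : R) r ->
    decided T delta (ratr r) w}.
  apply: ae_all_count => r; have [r01|nr] := pselect (rat_above (0 : R) r).
    by apply: filterS (ae_decided r01).
  by apply: nearW.
have nest := sequential_test_nested test htheta.
apply: filterS3 nest decr (ae_decided a01) => w nest dec deca.
split; first exact: recovered_iff_no_jump.
exact: right_continuous_iff_no_jump nest a01.
Qed.

Lemma ae_agree_iff_right_continuous a : 0 < a < 1 ->
  {ae P theta, forall w, right_continuous_at T a w} <->
  {ae P theta, forall w, agree a w}.
Proof.
move=> a01; split=> h; apply: filterS2 h (ae_regular a01) => w hw [h1 h2].
  exact/h1/h2.
exact/h2/h1.
Qed.

Let level n a := P theta [set w | le_time (T a w) (Some n)].

(** The hypothesis says that no rational separates [level n a] from the values of [level n] to the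
    right of [a]. *)
Lemma ae_no_jump a : 0 < a < 1 ->
  (forall n, ~ exists q : rat,
    [/\ 0 < a < 1, (level n a < (ratr q)%:E)%E &
        forall b, 0 < b < 1 -> a < b -> ((ratr q)%:E <= level n b)%E]) ->
  {ae P theta, forall w, no_jump T a w}.
Proof.
move=> a01 njump; have /andP[a0 a1] := a01.
have mT n b : 0 < b < 1 -> measurable [set w | le_time (T b w) (Some n)].
  have [rule _ _] := test; move=> /rule[st _ _].
  exact: natural_filtration_measurable (st n).
have nestP := sequential_test_nested test htheta.
apply/ae_foralln => n.
set A := [set w | le_time (T a w) (Some n)].
(* [B] is the event that the right limit at [a] is at most [n], so a jump seen at time [n] is [B]
   without [A]. Rational levels keep it measurable. *)
pose B := \bigcap_(r in rat_above a) [set w | le_time (T (ratr r) w) (Some n)].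
have mA : measurable A by exact: mT.
have mB : measurable B.
  rewrite /B -[X in measurable X]setCK setC_bigcap; apply: measurableC.
  rewrite bigcup_mkcond; apply: countable_bigcupT_measurable => // r.
  case: ifPn => // /set_mem/andP[ar r1]; apply: measurableC; apply: mT.
  by rewrite (lt_trans a0).
suff : P theta (B `\` A) = 0%E.
  move=> BA0; rewrite /almost_everywhere; exists (B `\` A); split=> //.
    exact: measurableD.
  by move=> w /= /not_implyP[Bw nAw]; split.
(* Otherwise a rational strictly between the two probabilities separates, since [B] almost surely
   implies stopping by [n] at every level above [a]. *)
have leBA : (P theta B <= P theta A)%E.
  rewrite leNgt; apply/negP => AB.
  have [fA fB] : P theta A \is a fin_num /\ P theta B \is a fin_num.
    by split; exact: fin_num_measure.
  move: AB; rewrite -(fineK fA) -(fineK fB) lte_fin => /rat_in_itvoo[q].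
  rewrite in_itv/= => /andP[Aq qB]; apply: (njump n); exists q.
  split=> //; first by rewrite /level -/A -(fineK fA) lte_fin.
  move=> b /andP[b0 b1] ab.
  apply: (@le_trans _ _ (P theta B)); first by rewrite -(fineK fB) lee_fin ltW.
  apply: ae_le_measure => //; first by apply: mT; rewrite b0.
  have [r /[!in_itv]/= /andP[ar rb]] := rat_in_itvoo ab.
  apply: negligibleS nestP => w [Bw nbw] nestw; apply: nbw => /=.
  apply: le_time_trans (nestw _ _ (lt_trans a0 ar) (ltW rb) b1).1 _.
  by apply: Bw; rewrite /rat_above/= ar (lt_trans rb).
have leAI : (P theta A <= P theta (B `&` A))%E.
  apply: ae_le_measure => //; first exact: measurableI.
  apply: negligibleS nestP => w [Aw nBAw] nestw; apply: nBAw; split=> //.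
  move=> r /andP[ar r1] /=.
  exact: le_time_trans (nestw _ _ a0 (ltW ar) r1).1 Aw.
apply/eqP; rewrite eq_le measure_ge0 andbT measureD//; last first.
  by rewrite ltey_eq fin_num_measure.
by rewrite sube_le0; exact: le_trans leBA leAI.
Qed.

(** The exceptional set collects, over all [n], the right jumps of [level n]; it depends on
    [theta]. *)
Lemma ae_agree_cocountable : exists2 C : set R, countable C &
  forall a, 0 < a < 1 -> ~ C a -> {ae P theta, forall w, agree a w}.
Proof.
exists (\bigcup_n [set a | exists q : rat,
    [/\ 0 < a < 1, (level n a < (ratr q)%:E)%E &
        forall b, 0 < b < 1 -> a < b -> ((ratr q)%:E <= level n b)%E]]).
  apply: bigcup_countable => // n _.
  exact: (countable_right_jumps (level n) [set a | 0 < a < 1]).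
move=> a a01 nC; have nj : {ae P theta, forall w, no_jump T a w}.
  by apply: ae_no_jump => // n jump; apply: nC; exists n.
by apply: filterS2 nj (ae_regular a01) => w njw [h _]; exact/h.
Qed.

End Recovery.
End Model.

(** The recovered test is a right limit in the level, so agreement is stated off a countable set,
    which may vary with [theta], and characterized level by level through right continuity. *)
Theorem theorem1 (d d' : measure_display) (Omega : measurableType d)
    (E : measurableType d') (R : realType) (p : nat)
    (Theta : set 'rV[R]_p) (F : 'rV[R]_p -> probability E R)
    (P : 'rV[R]_p -> probability Omega R) (X : nat -> Omega -> E)
    (theta0 : 'rV[R]_p)
    (hF : exponential_family Theta F)
    (hP : complete_model Theta P)
    (hX : iid_sample Theta P F X)
    (h0 : Theta theta0) :
  (forall (T : R -> Omega -> option nat) (delta : R -> Omega -> bool),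
     sequential_test Theta P X theta0 T delta ->
     always_valid Theta P X theta0 (pvalue_of_test T delta))
  /\
  (forall q : nat -> Omega -> R,
     always_valid Theta P X theta0 q ->
     sequential_test Theta P X theta0
       (time_of_pvalue q) (decision_of_pvalue q))
  /\
  (forall (T : R -> Omega -> option nat) (delta : R -> Omega -> bool),
     sequential_test Theta P X theta0 T delta ->
     (forall a, 0 < a < 1 ->
        almost_surely Theta P (fun w => delta a w = false -> T a w = None)) ->
     let q := pvalue_of_test T delta in
     let agree a w := (time_of_pvalue q a w, decision_of_pvalue q a w)
                      = (T a w, delta a w) in
     forall theta, Theta theta ->
       (exists2 C : set R, countable C &
          forall a, 0 < a < 1 -> ~ C a ->
            {ae P theta, forall w, agree a w})
       /\
       (forall a, 0 < a < 1 ->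
          ({ae P theta, forall w, right_continuous_at T a w} <->
           {ae P theta, forall w, agree a w}))).
Proof.
have [mX _] := hX; split=> [T delta|]; first exact: pvalue_of_test_always_valid.
split=> [q|T delta test Tinf q agree theta htheta].
  exact: time_of_pvalue_sequential_test.
split; first exact: ae_agree_cocountable test Tinf _ htheta.
by move=> a; exact: ae_agree_iff_right_continuous test Tinf _ htheta a.
Qed.
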